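(* Let $\mathcal{H}$ be a complex Hilbert space and $A\in\mathcal{B}(\mathcal{H})$. For a unit vector $x$ put $c(x)=\frac12\langle(|A|+|A^*|)x,x\rangle$ and \[ \xi(x)=\left\langle\left(\big||A|-c(x)I\big|^2+\big||A^*|-c(x)I\big|^2\right)x,x\right\rangle . \] Then \[ \omega^2(A)\le \frac12\left(\left\||A|^2+|A^*|^2\right\|-\inf_{\|x\|=1}\xi(x)\right). \]
   Context: $\mathcal{B}(\mathcal{H})$ denotes the algebra of bounded linear operators on $\mathcal{H}$; for an operator $T$, $|T|=(T^*T)^{1/2}$; $\omega(A)=\sup_{\|x\|=1}|\langle Ax,x\rangle|$ is the numerical radius and $\|\cdot\|$ the operator norm. *)

(* Defs.v *)
From HB Require Import structures.
From mathcomp Require Import all_boot all_order all_algebra.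
From mathcomp Require Import all_classical reals.
From mathcomp Require Import complex.
Set Implicit Arguments. Unset Strict Implicit. Unset Printing Implicit Defensive.
Import Order.TTheory GRing.Theory Num.Theory.
Local Open Scope ring_scope.
Local Open Scope classical_set_scope.

Definition hnorm (R : realType) (H : lmodType R[i]) (ip : H -> H -> R[i])
  (x : H) : R := Num.sqrt (complex.Re (ip x x)).

Record is_hilbert (R : realType) (H : lmodType R[i]) (ip : H -> H -> R[i])
  : Prop := {
  ip_linl : forall (a : R[i]) (x y z : H), ip (a *: x + y) z = a * ip x z + ip y z;
  ip_conj : forall x y : H, ip y x = conjc (ip x y);
  ip_ge0 : forall x : H, 0 <= ip x x;
  ip_def : forall x : H, ip x x = 0 -> x = 0;
  ip_complete : forall u : nat -> H,
    (forall e : R, 0 < e -> exists N : nat, forall m n : nat,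
        (N <= m)%N -> (N <= n)%N -> hnorm ip (u m - u n) < e) ->
    exists l : H, forall e : R, 0 < e -> exists N : nat, forall n : nat,
        (N <= n)%N -> hnorm ip (u n - l) < e }.

Definition is_bounded_op (R : realType) (H : lmodType R[i]) (ip : H -> H -> R[i])
  (T : H -> H) : Prop :=
  (forall (a : R[i]) (x y : H), T (a *: x + y) = a *: T x + T y) /\
  exists M : R, forall x : H, hnorm ip (T x) <= M * hnorm ip x.

Definition is_adjoint (R : realType) (H : lmodType R[i]) (ip : H -> H -> R[i])
  (T S : H -> H) : Prop := forall x y : H, ip (T x) y = ip x (S y).

Definition is_positive_op (R : realType) (H : lmodType R[i]) (ip : H -> H -> R[i])
  (P : H -> H) : Prop :=
  is_bounded_op ip P /\ is_adjoint ip P P /\ forall x : H, 0 <= ip (P x) x.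

(* P = |T| = (T^* T)^{1/2}, where Ts is the adjoint of T: P is the (unique)
   positive operator with P^2 = T^* T. *)
Definition is_op_abs (R : realType) (H : lmodType R[i]) (ip : H -> H -> R[i])
  (T Ts P : H -> H) : Prop :=
  is_adjoint ip T Ts /\ is_positive_op ip P /\ forall x : H, P (P x) = Ts (T x).

Definition unit_sphere (R : realType) (H : lmodType R[i]) (ip : H -> H -> R[i])
  : set H := [set x | hnorm ip x = 1].

Definition opnorm (R : realType) (H : lmodType R[i]) (ip : H -> H -> R[i])
  (T : H -> H) : R := sup [set hnorm ip (T x) | x in unit_sphere ip].

(* Numerical radius w(T) = sup_{||x||=1} |<T x, x>|; the complex modulus `|z|
   is real-valued (normC), so we take its real part to land in R. *)
Definition numrad (R : realType) (H : lmodType R[i]) (ip : H -> H -> R[i])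
  (T : H -> H) : R := sup [set complex.Re `|ip (T x) x| | x in unit_sphere ip].

(* Main.v *)
(** For a unit vector [x], expanding [xi x] gives
    [c x ^+ 2 = (<(|A|^2 + |A^*|^2) x, x> - xi x) / 2], so it suffices that
    [|<A x, x>| <= c x].  This follows from
    [2 Re <A x, y> <= <|A| x, x> + <|A^*| y, y>] by taking for [y] a unimodular
    multiple of [x].  The latter says that the operator matrix
    [[0, A^*], [A, 0]] on [H * H] is dominated by diag(|A|, |A^*|).  Both are
    symmetric with the same square, and a symmetric operator is dominated by any
    positive operator with the same square: this is shown directly, by
    estimating the infimum of the quadratic form of the difference, so neither
    functional calculus nor the polar decomposition is needed. *)

Require Import Defs.
From HB Require Import structures.
From mathcomp Require Import all_boot all_order all_algebra.
From mathcomp Require Import all_classical reals.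
From mathcomp Require Import complex.
From mathcomp Require Import ring lra.
Set Implicit Arguments.
Unset Strict Implicit.
Import Order.TTheory GRing.Theory Num.Theory.
Local Open Scope ring_scope.
Local Open Scope classical_set_scope.

(** * Real semidefinite forms and comparison of symmetric operators *)

(** Definiteness is left out so that [b (T x) y] with [T] positive is again such a form and obeys
    Cauchy-Schwarz. *)
Record psd_form (R : realType) (V : lmodType R[i]) (b : V -> V -> R) : Prop := {
  form_linl : forall (t : R) (x y z : V),
    b ((t%:C)%C *: x + y) z = t * b x z + b y z;
  form_sym : forall x y : V, b x y = b y x;
  form_ge0 : forall x : V, 0 <= b x x }.

Section Form.
Context (R : realType) (V : lmodType R[i]).
Implicit Types (b : V -> V -> R) (x y z : V).

Lemma formDl b x y z : psd_form b -> b (x + y) z = b x z + b y z.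
Proof.
by move=> hb; have := form_linl hb 1 x y z; rewrite mul1r [(_%:C)%C]/= scale1r.
Qed.

Lemma form0l b z : psd_form b -> b 0 z = 0.
Proof. by move=> hb; have := formDl 0 0 z hb; rewrite addr0; lra. Qed.

Lemma formZl b t x z : psd_form b -> b ((t%:C)%C *: x) z = t * b x z.
Proof.
by move=> hb; have := form_linl hb t x 0 z; rewrite addr0 form0l // addr0.
Qed.

Lemma formNl b x z : psd_form b -> b (- x) z = - b x z.
Proof.
by move=> hb; have := formDl x (- x) z hb; rewrite subrr form0l //; lra.
Qed.

Lemma formBl b x y z : psd_form b -> b (x - y) z = b x z - b y z.
Proof. by move=> hb; rewrite formDl // formNl. Qed.

Lemma formDr b x y z : psd_form b -> b z (x + y) = b z x + b z y.
Proof. by move=> hb; rewrite form_sym // formDl // !(form_sym hb z). Qed.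

Lemma formBr b x y z : psd_form b -> b z (x - y) = b z x - b z y.
Proof. by move=> hb; rewrite form_sym // formBl // !(form_sym hb z). Qed.

Lemma formZr b t x z : psd_form b -> b z ((t%:C)%C *: x) = t * b z x.
Proof. by move=> hb; rewrite form_sym // formZl // (form_sym hb z). Qed.

Lemma form_cauchy_schwarz b x y :
  psd_form b -> b x y ^+ 2 <= b x x * b y y.
Proof.
move=> hb.
have key t : 0 <= b x x + 2 * t * b x y + t ^+ 2 * b y y.
  have := form_ge0 hb ((t%:C)%C *: y + x).
  rewrite formDr // formZr // !form_linl // (form_sym hb y x).
  by rewrite [X in 0 <= X -> _](_ : _ = b x x + 2 * t * b x y + t ^+ 2 * b y y) //; ring.
have [y0|y0] := eqVneq (b y y) 0.
  have [->|xy0] := eqVneq (b x y) 0; first by rewrite y0 expr0n mulr0.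
  (* With [b y y = 0] the quadratic is affine in [t]; this [t] gives it the value -1. *)
  have := key (- (b x x + 1) / (2 * b x y)); rewrite y0 mulr0 addr0.
  by rewrite (_ : 2 * _ * _ = - (b x x + 1)) => [|]; [lra | field].
have ypos : 0 < b y y by rewrite lt_def y0 form_ge0.
(* The minimiser of the quadratic in [t]. *)
have := key (- b x y / b y y).
rewrite (_ : _ + _ = (b x x * b y y - b x y ^+ 2) / b y y); last by field.
by rewrite pmulr_lge0 ?invr_gt0 // subr_ge0.
Qed.

Lemma form_symmetric_op b (T : V -> V) : psd_form b ->
  (forall x y, b (T x) y = b x (T y)) -> (forall x, 0 <= b (T x) x) ->
  psd_form (fun x y => b (T x) y).
Proof.
move=> hb symT T_ge0; split => //.
  by move=> t x y z; rewrite symT form_linl // -!symT.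
by move=> x y; rewrite symT form_sym.
Qed.

Lemma form_le_of_norm_le b (T : V -> V) (M : R) x : psd_form b -> 0 <= M ->
  b (T x) (T x) <= M ^+ 2 * b x x -> `|b (T x) x| <= M * b x x.
Proof.
move=> hb M0 hT; have x0 := form_ge0 hb x.
rewrite -(ler_pXn2r (n := 2)) ?nnegrE ?mulr_ge0 // real_normK ?num_real //.
apply: (le_trans (form_cauchy_schwarz _ _ hb)).
by apply: le_trans (ler_wpM2r x0 hT) _; rewrite exprMn -mulrA -expr2.
Qed.

(* A lower bound [-s] of [P - A] can be improved: near a vector that almost
   attains it, [P - A] acts like [-s], so orthogonality of [(P - A) z] and
   [(P + A) z] forces [<P z, z> = - <A z, z>] approximately, whence
   [<(P - A) z, z> = 2 <P z, z>] is almost nonnegative. *)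
Lemma lower_bound_gap b (P A : V -> V) (M s : R) : psd_form b -> 0 <= M -> 0 < s ->
  (forall x y, b (P x) y = b x (P y)) -> (forall x y, b (A x) y = b x (A y)) ->
  (forall x, 0 <= b (P x) x) ->
  (forall x, b (P x) (P x) = b (A x) (A x)) ->
  (forall x, b (P x) (P x) <= M ^+ 2 * b x x) ->
  (forall x, - s * b x x <= b (P x) x - b (A x) x) ->
  exists2 eta, 0 < eta <= s &
    forall x, - (s - eta) * b x x <= b (P x) x - b (A x) x.
Proof.
move=> hb M0 s0 symP symA P0 PA PM hs.
(* [K] bounds the form of [E] below; [L] collects the constants of the last estimate, its [+ 1]
   keeping it positive when [M = 0]. *)
pose K := 2 * M + s.
pose L := 16 * K * (M ^+ 2 + 1).
have K0 : 0 < K by rewrite /K; lra.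
have M20 : 0 <= M ^+ 2 by exact: sqr_ge0.
have L0 : 0 < L by rewrite /L !mulr_gt0 //; lra.
pose E z := P z - A z + (s%:C)%C *: z.
have bE z w : b (E z) w = b (P z) w - b (A z) w + s * b z w.
  by rewrite /E formDl // formBl // formZl.
have hE : psd_form (fun x y => b (E x) y).
  apply: form_symmetric_op => // [x y|x].
    by rewrite bE /E formDr // formBr // formZr // symP symA.
  by rewrite bE; have := hs x; lra.
(* Cauchy-Schwarz for the form of [E] at [z] and [E z], with one factor [b (E z) (E z)] cancelled:
   if the form of [E] is small at [z], so is [E z]. *)
have E_sqr z : b (E z) (E z) <= K * b (E z) z.
  have [->|n0] := eqVneq (b (E z) (E z)) 0.
    by apply: mulr_ge0; [exact: ltW | exact: form_ge0 hE z].
  have npos : 0 < b (E z) (E z) by rewrite lt_def n0 form_ge0.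
  have := form_cauchy_schwarz z (E z) hE => /=.
  have EE : b (E (E z)) (E z) <= K * b (E z) (E z).
    set w := E z; rewrite bE.
    have := form_le_of_norm_le hb M0 (PM w).
    have := @form_le_of_norm_le b A M w hb M0; rewrite -PA => /(_ (PM w)).
    by rewrite !ler_norml /K => /andP[? ?] /andP[? ?]; lra.
  have d0 := form_ge0 hE z.
  move=> h; have := le_trans h (ler_wpM2l d0 EE).
  by rewrite expr2 mulrA ler_pM2r // mulrC.
(* One entry for each case below: [b (E x) x] at least [s / 2 * n], or smaller. *)
exists (Num.min (s / 2) (s ^+ 4 / L)) => [|x].
  rewrite lt_min ge_min !divr_gt0 ?exprn_gt0 //=.
  by apply/orP; left; lra.
have n0 := form_ge0 hb x.
set n := b x x in n0 *.
set eta := Num.min _ _.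
suff : eta * n <= b (E x) x by rewrite bE -/n; lra.
have [big|small] := leP (s / 2 * n) (b (E x) x).
  by apply: le_trans big; rewrite ler_wpM2r // /eta ge_min lexx.
suff h : s ^+ 4 * n <= L * b (E x) x.
  apply: (@le_trans _ _ (s ^+ 4 / L * n)).
    by rewrite ler_wpM2r // /eta ge_min lexx orbT.
  by rewrite mulrAC ler_pdivrMr // [X in _ <= X]mulrC.
have npos : 0 < n.
  rewrite lt_def n0 andbT; apply: contraTneq small => ->.
  by rewrite mulr0 -leNgt; exact: form_ge0 hE x.
(* [P x - A x] and [P x + A x] are orthogonal by [PA] and symmetry of [b], so only the [s] term of
   [E] survives. *)
have orth : b (E x) (P x + A x) = s * (b (P x) x + b (A x) x).
  rewrite bE !formDr // PA (form_sym hb (A x) (P x)).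
  by rewrite (form_sym hb x (P x)) (form_sym hb x (A x)); ring.
have low : s ^+ 2 / 2 * n <= b (E x) (P x + A x).
  rewrite orth.
  have : s / 2 * n <= b (P x) x + b (A x) x.
    by have := P0 x; move: small; rewrite bE -/n; lra.
  by move/(ler_wpM2l (ltW s0)); lra.
(* Parallelogram bound, with [b (A x) (A x)] replaced through [PA]. *)
have sum_sqr : b (P x + A x) (P x + A x) <= 4 * M ^+ 2 * n.
  have := form_ge0 hb (P x - A x); rewrite formBl // !formBr // formDl // !formDr //.
  by rewrite (form_sym hb (A x) (P x)) -PA; have := PM x; rewrite -/n; lra.
have sq : (s ^+ 2 / 2 * n) ^+ 2 <= K * b (E x) x * (4 * M ^+ 2 * n).
  have l0 : 0 <= s ^+ 2 / 2 * n.
    by apply: mulr_ge0 => //; apply: divr_ge0 => //; exact: sqr_ge0.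
  apply: le_trans (_ : b (E x) (P x + A x) ^+ 2 <= _).
    by rewrite ler_pXn2r // nnegrE //; exact: le_trans low.
  apply: le_trans (form_cauchy_schwarz _ _ hb) _.
  by apply: ler_pM => //; exact: form_ge0.
have : s ^+ 4 * n * n <= 16 * K * M ^+ 2 * b (E x) x * n.
  rewrite (_ : s ^+ 4 * n * n = 4 * (s ^+ 2 / 2 * n) ^+ 2); last by field.
  by move: sq; lra.
rewrite ler_pM2r // => /le_trans; apply.
rewrite /L ler_wpM2r ?ler_wpM2l //; first exact: form_ge0 hE x.
- by apply: mulr_ge0 => //; exact: ltW.
- lra.
Qed.

(** The least [s] for which [- s] bounds [P - A] from below is attained; were it positive,
    [lower_bound_gap] would give a smaller one. *)
Lemma form_le_of_norm_eq b (P A : V -> V) (M : R) x : psd_form b -> 0 <= M ->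
  (forall x y, b (P x) y = b x (P y)) -> (forall x y, b (A x) y = b x (A y)) ->
  (forall x, 0 <= b (P x) x) ->
  (forall x, b (P x) (P x) = b (A x) (A x)) ->
  (forall x, b (P x) (P x) <= M ^+ 2 * b x x) ->
  b (A x) x <= b (P x) x.
Proof.
move=> hb M0 symP symA P0 PA PM.
pose S := [set s : R | 0 <= s /\
  forall x, - s * b x x <= b (P x) x - b (A x) x].
have S0 : S !=set0.
  exists M; split => // z; have := P0 z.
  have := @form_le_of_norm_le b A M z hb M0; rewrite -PA => /(_ (PM z)).
  by rewrite ler_norml => /andP[? ?]; lra.
have lbS : lbound S 0 by move=> s [].
have hS : has_inf S by split => //; exists 0.
have infS : S (inf S).
  split; first exact: lb_le_inf.
  (* On null vectors the bound does not depend on [s]; elsewhere divide by [b z z] and pass to the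
     infimum. *)
  move=> z; have := form_ge0 hb z; rewrite le_eqVlt => /predU1P[z0|zpos].
    by have [s [_ /(_ z)]] := S0; rewrite -z0 !mulr0.
  suff : (b (A z) z - b (P z) z) / b z z <= inf S.
    by rewrite ler_pdivrMr //; lra.
  apply: lb_le_inf => // s [_ /(_ z) h]; rewrite ler_pdivrMr //; lra.
have [inf0 hinf] := infS.
move: (inf0); rewrite le_eqVlt => /predU1P[i0|ipos].
  by have := hinf x; rewrite -i0 oppr0 mul0r subr_ge0.
have [eta /andP[eta0 etas] heta] :=
  lower_bound_gap hb M0 ipos symP symA P0 PA PM hinf.
have : inf S <= inf S - eta.
  by apply: ge_inf; [exists 0 | split => //; rewrite subr_ge0].
by rewrite lerDl oppr_ge0 leNgt eta0.
Qed.

End Form.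

(** * Operator moduli on a Hilbert space *)

Section Hilbert.
Context (R : realType) (H : lmodType R[i]) (ip : H -> H -> R[i]).
Hypothesis hH : is_hilbert ip.

Lemma hilbert_psd_form : psd_form (fun x y => complex.Re (ip x y)).
Proof.
split=> [t x y z|x y|x].
- by rewrite (ip_linl hH); case: (ip x z) => a b; case: (ip y z) => c d /=; ring.
- by rewrite (ip_conj hH); case: (ip y x).
- by have := ip_ge0 hH x; rewrite lecE => /andP[].
Qed.

Lemma sqr_hnorm x : hnorm ip x ^+ 2 = complex.Re (ip x x).
Proof. by rewrite sqr_sqrtr //; exact: (form_ge0 hilbert_psd_form). Qed.

Lemma hnorm_ge0 x : 0 <= hnorm ip x.
Proof. exact: sqrtr_ge0. Qed.

Lemma bounded_op_sqr T : is_bounded_op ip T ->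
  exists2 M : R, 0 <= M &
    forall x, complex.Re (ip (T x) (T x)) <= M ^+ 2 * complex.Re (ip x x).
Proof.
move=> [_ [M hM]]; exists `|M| => // x.
rewrite -!sqr_hnorm -exprMn ler_pXn2r // ?nnegrE ?mulr_ge0 ?hnorm_ge0 //.
by apply: le_trans (hM x) _; rewrite ler_wpM2r ?hnorm_ge0 // ler_norm.
Qed.

Definition ip_prod (z w : H * H) : R :=
  complex.Re (ip z.1 w.1) + complex.Re (ip z.2 w.2).

Lemma ip_prod_psd_form : psd_form ip_prod.
Proof.
have hb := hilbert_psd_form.
split=> [t x y z|x y|x]; rewrite /ip_prod.
- by have /= -> := form_linl hb t x.1 y.1 z.1;
     have /= -> := form_linl hb t x.2 y.2 z.2; ring.
- by have /= -> := form_sym hb x.1 y.1; have /= -> := form_sym hb x.2 y.2.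
- by apply: addr_ge0; exact: (form_ge0 hb).
Qed.

(* [form_le_of_norm_eq] for the operator matrices diag(|A|, |A^*|) and
   [[0, A^*], [A, 0]] on [H * H], which have the same square. *)
Lemma mixed_schwarz A As P Q x y :
  is_op_abs ip A As P -> is_op_abs ip As A Q ->
  2 * complex.Re (ip (A x) y) <=
    complex.Re (ip (P x) x) + complex.Re (ip (Q y) y).
Proof.
move=> [adjA [[bP [symP P0]] PP]] [adjAs [[bQ [symQ Q0]] QQ]].
have hb := hilbert_psd_form.
have [M M0 hM] := bounded_op_sqr bP; have [N N0 hN] := bounded_op_sqr bQ.
have nP z : ip (P z) (P z) = ip (A z) (A z) by rewrite symP PP adjA.
have nQ z : ip (Q z) (Q z) = ip (As z) (As z) by rewrite symQ QQ adjAs.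
pose D (z : H * H) := (P z.1, Q z.2).
pose B (z : H * H) := (As z.2, A z.1).
(* [M + N] dominates the bounds of both diagonal blocks. *)
have := @form_le_of_norm_eq _ _ ip_prod D B (M + N) (x, y) ip_prod_psd_form.
rewrite /ip_prod /=.
(* The two off-diagonal terms have equal real part, whence the factor 2. *)
have /= -> : complex.Re (ip (As y) x) = complex.Re (ip (A x) y).
  by rewrite adjAs; exact: (form_sym hb).
rewrite mulr_natl mulr2n; apply; first exact: addr_ge0.
- by move=> z w /=; rewrite symP symQ.
- by move=> z w /=; rewrite adjA adjAs addrC.
- move=> z /=; apply: addr_ge0.
    by have := P0 z.1; rewrite lecE => /andP[].
  by have := Q0 z.2; rewrite lecE => /andP[].
- by move=> z /=; rewrite nP nQ addrC.
- move=> z /=; rewrite mulrDr; apply: lerD.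
    apply: le_trans (hM _) _; rewrite ler_wpM2r ?(form_ge0 hb) //.
    by rewrite ler_pXn2r ?nnegrE ?addr_ge0 // lerDl.
  apply: le_trans (hN _) _; rewrite ler_wpM2r ?(form_ge0 hb) //.
  by rewrite ler_pXn2r ?nnegrE ?addr_ge0 // lerDr.
Qed.

Lemma ipZr a x y : ip x (a *: y) = conjc a * ip x y.
Proof.
have ip0 z : ip 0 z = 0.
  have := ip_linl hH 1 0 0 z; rewrite scale1r addr0 mul1r => h.
  by apply: (addrI (ip 0 z)); rewrite addr0 -h.
have := ip_linl hH a y 0 x; rewrite addr0 ip0 addr0 => h.
by rewrite (ip_conj hH) h rmorphM /= -(ip_conj hH).
Qed.

(** Take [a] divided by its modulus, or 1 if [a = 0]. The conjugate appears because [ip] is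
    conjugate-linear on the right. *)
Lemma phase_conj (a : R[i]) :
  exists2 u : R[i], conjc u * a = `|a| & conjc u * u = 1.
Proof.
have [->|a0] := eqVneq a 0.
  by exists 1; rewrite ?normr0 ?mulr0 // rmorph1 mulr1.
have n0 : `|a| != 0 by rewrite normr_eq0.
have hn : conjc a * a = `|a| ^+ 2 by rewrite sqr_normc mulrC.
have cn : conjc `|a| = `|a| by rewrite normc_def conjc_real.
have cu : conjc (a / `|a|) = conjc a / `|a|.
  by apply: etrans (rmorphM _ _ _) _; congr (_ * _); rewrite -[in RHS]cn -conjc_inv.
exists (a / `|a|); rewrite cu mulrAC.
  by rewrite hn expr2 mulfK.
by rewrite mulrA hn expr2 mulfK // divff.
Qed.

(** Apply [mixed_schwarz] to [x] and [u *: x]: the left side becomes twice the modulus, while the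
    [Q] term ignores the phase. *)
Lemma op_abs_numrad_le A As P Q x :
  is_op_abs ip A As P -> is_op_abs ip As A Q ->
  complex.Re `|ip (A x) x| <= 2^-1 * complex.Re (ip (P x + Q x) x).
Proof.
move=> hP hQ; have [u ua uu] := phase_conj (ip (A x) x).
have := mixed_schwarz x (u *: x) hP hQ.
have [_ [[_ [symQ _]] _]] := hQ.
have -> : ip (Q (u *: x)) (u *: x) = ip (Q x) x.
  rewrite ipZr symQ (ip_conj hH) ipZr rmorphM /= conjcK mulrA.
  rewrite -(ip_conj hH) uu mul1r symQ //.
rewrite ipZr ua; have /= -> := formDl (P x) (Q x) x hilbert_psd_form.
lra.
Qed.

End Hilbert.

(** * The inequality on unit vectors, then for the suprema *)

Theorem theorem2p9 (R : realType) (H : lmodType R[i]) (ip : H -> H -> R[i])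
  (hH : is_hilbert ip) (A As P Q : H -> H)
  (hA : is_bounded_op ip A) (hAs : is_adjoint ip A As)
  (hP : is_op_abs ip A As P) (hQ : is_op_abs ip As A Q) :
  let c := fun x : H => 2^-1 * complex.Re (ip (P x + Q x) x) in
  let xi := fun x : H =>
    complex.Re (ip ((P (P x - ((c x)%:C)%C *: x) - ((c x)%:C)%C *: (P x - ((c x)%:C)%C *: x))
                  + (Q (Q x - ((c x)%:C)%C *: x) - ((c x)%:C)%C *: (Q x - ((c x)%:C)%C *: x))) x) in
  numrad ip A ^+ 2 <=
    2^-1 * (opnorm ip (fun x => P (P x) + Q (Q x)) - inf [set xi x | x in unit_sphere ip]).
Proof.
pose c x := 2^-1 * complex.Re (ip (P x + Q x) x).
pose xi x := complex.Re (ip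
  ((P (P x - ((c x)%:C)%C *: x) - ((c x)%:C)%C *: (P x - ((c x)%:C)%C *: x))
   + (Q (Q x - ((c x)%:C)%C *: x) - ((c x)%:C)%C *: (Q x - ((c x)%:C)%C *: x))) x).
change (numrad ip A ^+ 2 <= 2^-1 * (opnorm ip (fun x => P (P x) + Q (Q x))
                                    - inf [set xi x | x in unit_sphere ip])).
pose b x y := complex.Re (ip x y).
have hb : psd_form b := hilbert_psd_form hH.
have [_ [[bP [symP _]] _]] := hP; have [_ [[bQ [symQ _]] _]] := hQ.
have symPb x y : b (P x) y = b x (P y) by rewrite /b symP.
have symQb x y : b (Q x) y = b x (Q y) by rewrite /b symQ.
(* Symmetry of [P] and [Q] turns [xi] into a sum of squared norms, so 0 bounds the infimum below. *)
have xiE x : xi x = b (P x - ((c x)%:C)%C *: x) (P x - ((c x)%:C)%C *: x)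
                  + b (Q x - ((c x)%:C)%C *: x) (Q x - ((c x)%:C)%C *: x).
  rewrite /xi -/(b _ _); set k := c x.
  set u := P x - _; set v := Q x - _.
  rewrite (formDl _ _ _ hb) !(formBl _ _ _ hb) !(formZl _ _ _ hb) symPb symQb.
  by rewrite !(form_sym hb u) !(form_sym hb v).
have xi_ge0 x : 0 <= xi x by rewrite xiE addr_ge0 // (form_ge0 hb).
(* Without unit vectors, [sup] and [inf] of the empty set default to 0 and both sides vanish. *)
have [S0|/set0P S0] := eqVneq (unit_sphere ip) set0.
  by rewrite /numrad /opnorm S0 !image_set0 sup0 inf0 subr0 mulr0 expr0n.
have unitE x : unit_sphere ip x -> b x x = 1.
  by move=> hx; rewrite /b -(sqr_hnorm hH) hx expr1n.
have c_sqr x : unit_sphere ip x ->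
    c x ^+ 2 = 2^-1 * (b (P (P x) + Q (Q x)) x - xi x).
  move=> /unitE x1; rewrite xiE.
  have hc : c x = 2^-1 * (b (P x) x + b (Q x) x) by rewrite /c -formDl.
  rewrite !formBl // !formBr // !formZl // !formZr // x1 formDl //.
  rewrite symPb (symQb (Q x)) (form_sym hb x (P x)) (form_sym hb x (Q x)).
  set k := c x in hc *; rewrite (_ : b (Q x) x = 2 * k - b (P x) x); last by lra.
  by field.
set T := fun x => P (P x) + Q (Q x).
have opnorm_ub x : unit_sphere ip x -> b (T x) x <= opnorm ip T.
  move=> hx; apply: (@le_trans _ _ (hnorm ip (T x))).
    apply: le_trans (ler_norm _) _.
    rewrite -(ler_pXn2r (n := 2)) ?nnegrE ?hnorm_ge0 // real_normK ?num_real //.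
    apply: le_trans (form_cauchy_schwarz _ _ hb) _.
    by rewrite (unitE x) // mulr1 sqr_hnorm.
  apply: ub_le_sup; last by exists x.
  have [M M0 hM] := bounded_op_sqr hH bP; have [N N0 hN] := bounded_op_sqr hH bQ.
  (* The supremum is an upper bound only if the set is bounded; this bound comes from the
     parallelogram inequality for [P (P y)] and [Q (Q y)]. *)
  exists (Num.sqrt (2 * ((M ^+ 2) ^+ 2 + (N ^+ 2) ^+ 2))) => _ [y hy <-].
  rewrite ler_wsqrtr // -/(b _ _).
  have PP : b (P (P y)) (P (P y)) <= (M ^+ 2) ^+ 2.
    apply: le_trans (hM _) _; rewrite expr2 ler_wpM2l ?sqr_ge0 //.
    by apply: le_trans (hM _) _; rewrite -/(b _ _) unitE // mulr1.
  have QQ : b (Q (Q y)) (Q (Q y)) <= (N ^+ 2) ^+ 2.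
    apply: le_trans (hN _) _; rewrite expr2 ler_wpM2l ?sqr_ge0 //.
    by apply: le_trans (hN _) _; rewrite -/(b _ _) unitE // mulr1.
  have := form_ge0 hb (P (P y) - Q (Q y)); rewrite formBl // !formBr //.
  rewrite /T formDl // !formDr // (form_sym hb (Q (Q y)) (P (P y))); lra.
have B_ub x : unit_sphere ip x -> complex.Re `|ip (A x) x| ^+ 2 <=
    2^-1 * (opnorm ip T - inf [set xi x | x in unit_sphere ip]).
  move=> hx; apply: (@le_trans _ _ (c x ^+ 2)).
    have := op_abs_numrad_le hH x hP hQ; rewrite -/(c x) => h.
    have n0 : 0 <= complex.Re `|ip (A x) x|.
      by have := normr_ge0 (ip (A x) x); rewrite lecE => /andP[].
    by rewrite ler_pXn2r // nnegrE //; exact: le_trans h.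
  rewrite c_sqr // ler_wpM2l ?invr_ge0 // lerB ?opnorm_ub //.
  by apply: ge_inf; [exists 0 => _ [y _ <-] | exists x].
set B := 2^-1 * _ in B_ub *.
have [x0 hx0] := S0.
have B0 : 0 <= B by exact: le_trans (sqr_ge0 _) (B_ub _ hx0).
(* Comparing with [Num.sqrt B] allows the square to be taken after the supremum. *)
rewrite -[B]sqr_sqrtr //.
have ub : ubound [set complex.Re `|ip (A x) x| | x in unit_sphere ip] (Num.sqrt B).
  move=> _ [x hx <-].
  by apply: le_trans (ler_norm _) _; rewrite -sqrtr_sqr ler_wsqrtr // B_ub.
rewrite ler_pXn2r ?nnegrE ?sqrtr_ge0 //.
  by apply: ge_sup => //; exists (complex.Re `|ip (A x0) x0|), x0.
(* Removing the squares also requires [numrad] to be nonnegative; it dominates its value at [x0]. *)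
apply: (@le_trans _ _ (complex.Re `|ip (A x0) x0|)).
  by have := normr_ge0 (ip (A x0) x0); rewrite lecE => /andP[].
by apply: ub_le_sup; [exists (Num.sqrt B) | exists x0].
Qed.
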